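(* For every $n\ge2$ and $\pi/2<\theta<\pi$, there exists a smooth one-ended rotational support $S_\rho\subset\mathbb R^{n+1}$ without cylindrical intervals, with $\rho$ defined on $[0,\infty)$, such that $$0<\rho'<-\cot\theta\qquad\text{on }[0,\infty),$$ and $S_\rho$ supports an admissible $\theta$-capillary catenoid band with boundary heights $a<b$ satisfying $$A_\theta(b)=B_\theta(a).$$
   Context: Write points of $\mathbb R^{n+1}$ as $(y,z)$, $y\in\mathbb R^n$, $z\in\mathbb R$. A smooth one-ended rotational support is given by $0<L\le\infty$ (here $L=\infty$) and a positive smooth function $\rho$ on $[0,L)$ whose meridian is proper and complete as $z\uparrow L$ (the curve $z\mapsto(\rho(z),z)$ leaves every compact set of $\mathbb R^2$ and has infinite length as $z\uparrow L$), through $$S_\rho=\{(\rho(z)\omega,z):\omega\in\mathbb S^{n-1},\ 0\le z<L\},\qquad M_\rho=\{(y,z):|y|\le\rho(z),\ 0\le z<L\},\qquad N_{S_\rho}=\frac{(\omega,-\rho')}{\sqrt{1+\rho'^2}} .$$ $N_{S_\rho}$ is the outward unit normal of $M_\rho$ along $S_\rho$. ''Without cylindrical intervals'' means that $\rho'$ does not vanish identically on any nondegenerate interval. Define $\ell_\theta=\sup\{b\in[0,L):\rho'(b)<-\cot\theta\}$ (and $\ell_\theta=0$ if this set is empty), and $$A_\theta=\frac{\rho^{n-1}(1+\tan\theta\,\rho')}{\sqrt{1+\rho'^2}},\qquad B_\theta=\frac{\rho^{n-1}(1-\tan\theta\,\rho')}{\sqrt{1+\rho'^2}}$$ as functions of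 the height $z\in[0,L)$. An admissible $\theta$-capillary catenoid band is a connected rotational minimal hypersurface $$\Sigma_f=\{(f(z)\omega,z):a\le z\le b,\ \omega\in\mathbb S^{n-1}\},\qquad f>0,\quad 0<a<b<\ell_\theta,$$ whose boundary consists of the two horizontal spheres in $S_\rho$ at heights $a$ and $b$ (the boundary heights), whose interior lies in $\operatorname{int}M_\rho$, and which meets $S_\rho$ at the constant contact angle $\theta$ along both boundary components. Explicitly: $ff''=(n-1)(1+f'^2)$; $f(a)=\rho(a)$, $f(b)=\rho(b)$, $f<\rho$ on $(a,b)$; and $$\arctan\rho'(a)-\arctan f'(a)=\pi-\theta,\qquad \arctan\rho'(b)-\arctan f'(b)=-(\pi-\theta).$$ *)

(* Defs.v *)
From HB Require Import structures.
From mathcomp Require Import all_boot all_order all_algebra.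
From mathcomp Require Import all_classical all_reals all_analysis.
Set Implicit Arguments.
Unset Strict Implicit.
Unset Printing Implicit Defensive.
Import Order.TTheory GRing.Theory Num.Theory.
Import numFieldNormedType.Exports.
Local Open Scope classical_set_scope.
Local Open Scope ring_scope.

Section Defs.
Context {R : realType}.

Definition cot (x : R) : R := cos x / sin x.

(* A function that is smooth on a set D which need not be open (such as [0, L)
   or [a, b]) is represented by a total function that is infinitely
   differentiable on an open neighbourhood of D.  In this way derive1 g, the
   two-sided derivative, is also the right derivative at the endpoint 0. *)
Definition smooth_on (D : set R) (g : R -> R) : Prop :=
  exists2 U : set R, open U &
    D `<=` U /\ forall (k : nat) (x : R), U x -> derivable (derive1n k g) x 1.

(* 'rV[R]_n carries the sup norm in the library. *)
Definition enorm n (y : 'rV[R]_n) : R := Num.sqrt (\sum_i y ord0 i ^+ 2).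

Definition usphere n : set 'rV[R]_n := [set w | enorm w = 1].

(* The part over the heights I of the rotation hypersurface with profile g, as
   a subset of R^(n+1) = R^n x R. *)
Definition rot_hypersurface n (g : R -> R) (I : set R) : set ('rV[R]_n * R) :=
  [set p | exists2 w, usphere w & exists2 z, I z & p = (g z *: w, z)].
Arguments rot_hypersurface n g I : clear implicits.

(* [0, L), where L may be +oo. *)
Definition heights (L : \bar R) : set R := [set z | 0 <= z /\ (z%:E < L)%E].

Definition support n (L : \bar R) (rho : R -> R) : set ('rV[R]_n * R) :=
  rot_hypersurface n rho (heights L).
Arguments support n L rho : clear implicits.

Definition body n (L : \bar R) (rho : R -> R) : set ('rV[R]_n * R) :=
  [set p | heights L p.2 /\ enorm p.1 <= rho p.2].
Arguments body n L rho : clear implicits.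

Definition proper_meridian (L : \bar R) (rho : R -> R) : Prop :=
  forall K : set (R * R), compact K ->
    exists2 z0, heights L z0 &
      forall z, heights L z -> z0 <= z -> ~ K (rho z, z).

Definition speed (g : R -> R) (z : R) : R := Num.sqrt (1 + derive1 g z ^+ 2).

Definition complete_meridian (L : \bar R) (rho : R -> R) : Prop :=
  (\int[lebesgue_measure]_(z in heights L) (speed rho z)%:E = +oo)%E.

Record one_ended_support (L : \bar R) (rho : R -> R) : Prop := {
  oes_length : (0 < L)%E;
  oes_smooth : smooth_on (heights L) rho;
  oes_pos : forall z, heights L z -> 0 < rho z;
  oes_proper : proper_meridian L rho;
  oes_complete : complete_meridian L rho
}.

Definition no_cylindrical_interval (L : \bar R) (rho : R -> R) : Prop :=
  forall c d : R, c < d -> [set` `[c, d]] `<=` heights L ->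
    ~ (forall z, z \in `[c, d] -> derive1 rho z = 0).

(* The maximum with 0 only matters for the empty set, whose ereal_sup is -oo. *)
Definition ell (L : \bar R) (rho : R -> R) (theta : R) : \bar R :=
  maxe 0%E
    (ereal_sup [set b%:E | b in [set b | heights L b /\ derive1 rho b < - cot theta]]).

Definition Atheta n (rho : R -> R) (theta z : R) : R :=
  rho z ^+ n.-1 * (1 + tan theta * derive1 rho z) / speed rho z.

Definition Btheta n (rho : R -> R) (theta z : R) : R :=
  rho z ^+ n.-1 * (1 - tan theta * derive1 rho z) / speed rho z.

(* Sigma is the band Sigma_f over the heights [a, b].  The equation
   f f'' = (n - 1) (1 + f'^2) expresses that Sigma_f is minimal, and the two
   arctan equations that it meets the support at the contact angle theta, the
   band lying inside the body. *)
Record capillary_band_of n (L : \bar R) (rho : R -> R) (theta : R)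
    (f : R -> R) (Sigma : set ('rV[R]_n * R)) (a b : R) : Prop := {
  cb_eq : Sigma = rot_hypersurface n f [set` `[a, b]];
  cb_a_gt0 : 0 < a;
  cb_lt : a < b;
  cb_b_lt : (b%:E < ell L rho theta)%E;
  cb_smooth : smooth_on [set` `[a, b]] f;
  cb_pos : forall z, z \in `[a, b] -> 0 < f z;
  cb_minimal : forall z, z \in `[a, b] ->
    f z * derive1n 2 f z = (n.-1)%:R * (1 + derive1 f z ^+ 2);
  cb_fa : f a = rho a;
  cb_fb : f b = rho b;
  cb_below : forall z, z \in `]a, b[ -> f z < rho z;
  cb_boundary : rot_hypersurface n f [set a; b] `<=` support n L rho;
  cb_interior : rot_hypersurface n f [set` `]a, b[] `<=` (body n L rho)°;
  cb_angle_a : atan (derive1 rho a) - atan (derive1 f a) = pi - theta;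
  cb_angle_b : atan (derive1 rho b) - atan (derive1 f b) = - (pi - theta)
}.

Definition admissible_band n (L : \bar R) (rho : R -> R) (theta : R)
    (Sigma : set ('rV[R]_n * R)) (a b : R) : Prop :=
  exists f : R -> R, capillary_band_of L rho theta f Sigma a b.

End Defs.

Arguments rot_hypersurface {R} n g I.
Arguments support {R} n L rho.
Arguments body {R} n L rho.

(* Main.v *)
(** Put t = tan (pi - theta) and let s > 0 be small. If rho' = s at both boundary
heights, the contact angle conditions prescribe the end slopes of the meridian:
f' (a) = - q and f' (b) = p, with q = (t - s) / (1 + s t) and p = (t + s) / (1 - s t).
The catenary of scale one satisfies f ^ (n - 1) = sqrt (1 + f'^2), and with these end
slopes A_theta (b) = B_theta (a) holds identically in s. It remains to find a support.
Let l be the height of the band and m its mean slope (f b - f a) / l; then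
s / 2 < m = O(s) as s -> 0, whereas l stays away from 0. Therefore
rho' (z) = m - (m - s) cos (2 pi (z - a) / l) takes values between s and 2 m - s, so in
]0, - cot theta[, and |rho''| < f'' on the band: f - rho is convex there and vanishes
at both ends, which puts the band inside the body. *)
Require Import Defs.
From mathcomp Require Import all_boot all_order all_algebra.
From mathcomp Require Import all_classical all_reals all_analysis.
From mathcomp Require Import measurable_realfun ring lra.
Set Implicit Arguments.
Unset Strict Implicit.
Unset Printing Implicit Defensive.
Import Order.TTheory GRing.Theory Num.Theory.
Import numFieldNormedType.Exports.
Local Open Scope classical_set_scope.
Local Open Scope ring_scope.

(** * Smoothness, primitives and autonomous equations *)

Lemma near_eq_is_derive {R : realType} (f g : R -> R) (x l : R) :
  (\near x, f x = g x) -> is_derive x 1 f l -> is_derive x 1 g l.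
Proof.
move=> fg [df dl]; split.
  by apply: near_eq_derivable df; rewrite ?oner_neq0.
by rewrite -dl; apply/esym/near_eq_derive; rewrite ?oner_neq0.
Qed.

Lemma is_derive_derive1 {R : realType} (f : R -> R) (x l : R) :
  is_derive x 1 f l -> derive1 f x = l.
Proof. by move=> h; rewrite derive1E; exact: derive_val. Qed.

(** By induction, each iterated derivative of a member of [C] agrees on [U] with another member; as
    [U] is open, the agreement holds near each point of [U] and passes to the derivative. *)
Lemma smooth_on_class {R : realType} (C : set (R -> R)) (U D : set R) :
  open U -> D `<=` U ->
  (forall g, C g ->
    exists2 g', C g' & forall x, U x -> is_derive x 1 g (g' x)) ->
  forall g, C g -> smooth_on D g.
Proof.
move=> oU DU CU g Cg; exists U => //; split => // k x Ux.
have [h Ch hE] : exists2 h, C h & forall y, U y -> derive1n k g y = h y.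
  elim: k => [|k [h Ch hE]]; first by exists g.
  have [h' Ch' hh'] := CU h Ch; exists h' => // y Uy.
  rewrite derive1nS; apply: is_derive_derive1.
  apply: near_eq_is_derive (hh' y Uy).
  near=> z; rewrite hE//; near: z; exact: open_nbhs_nbhs.
have [h' _ hh'] := CU h Ch.
have : is_derive x 1 (derive1n k g) (h' x).
  apply: near_eq_is_derive (hh' x Ux).
  near=> z; rewrite hE//; near: z; exact: open_nbhs_nbhs.
by case.
Unshelve. all: by end_near. Qed.

Lemma exists_primitive {R : realType} (w : R -> R) (a b : R) :
  continuous w ->
  exists Z : R -> R, forall x, x \in `]a, b[ -> is_derive x 1 Z (w x).
Proof.
move=> cw.
exists (fun x => \int[lebesgue_measure]_(t in [set` `[a, x]]) w t)%R => x.
rewrite in_itv/= => /andP[ax xb].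
have [|dF FE] := @continuous_FTC1_closed R w a x b xb _ ax (cw x).
  apply: continuous_compact_integrable; first exact: segment_compact.
  by apply: continuous_subspaceT.
by split => //; rewrite -derive1E.
Qed.

Lemma is_derive_lt {R : realType} (f f' : R -> R) (a b : R) : a < b ->
  (forall x, x \in `[a, b] -> is_derive x 1 f (f' x)) ->
  (forall x, x \in `]a, b[ -> 0 < f' x) -> f a < f b.
Proof.
move=> ab df f'0.
have h1 x : x \in `]a, b[ -> is_derive x 1 f (f' x).
  by rewrite in_itv/= => /andP[/ltW ax /ltW xb]; apply: df; rewrite in_itv/= ax.
have h2 : {within `[a, b], continuous f}.
  apply: derivable_within_continuous => x xab.
  by have [] := df x xab.
have [c cab e] := MVT ab h1 h2.
by rewrite -subr_gt0 e mulr_gt0 ?subr_gt0// f'0.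
Qed.

(* The inverse of a primitive of [1 / h] solves [X' = h X]. *)
Lemma autonomous_ode_crossing {R : realType} (h : R -> R) (z0 a b : R) :
  continuous h -> (forall x, 0 < h x) -> a < b ->
  exists z1 (X : R -> R) (U : set R),
    [/\ z0 < z1, X z0 = a, X z1 = b & 
      [/\ open U, [set` `[z0, z1]] `<=` U &
        forall z, U z -> is_derive z 1 X (h (X z))]].
Proof.
move=> ch h0 ab.
have cw : continuous (fun x => (h x)^-1).
  by move=> x; apply: continuousV; [rewrite gt_eqF | exact: ch].
(* The unit margins leave room for the solution to be differentiable on an open neighbourhood of
   [[z0, z1]], endpoints included. *)
have [Z0 dZ0] := @exists_primitive R _ (a - 1) (b + 1) cw.
pose Z x := Z0 x + (z0 - Z0 a).
have dZ x : x \in `]a - 1, b + 1[ -> is_derive x 1 Z (h x)^-1.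
  move=> /dZ0 d; have := @is_deriveD _ _ _ _ _ _ _ _ _ d (is_derive_cst (z0 - Z0 a) x 1).
  by rewrite addr0.
have Zlt x y : a - 1 < x -> y < b + 1 -> x < y -> Z x < Z y.
  move=> ax yb xy; 
  pose w u := (h u)^-1.
  have d u : u \in `[x, y] -> is_derive u 1 Z (w u).
    rewrite in_itv/= => /andP[xu uy]; apply: dZ; rewrite in_itv/=.
    by rewrite (lt_le_trans ax xu) (le_lt_trans uy yb).
  by apply: (is_derive_lt xy d) => u _; rewrite invr_gt0.
pose I := [set x : R | x \in `]a - 1, b + 1[].
have Zinj x y : I x -> I y -> Z x = Z y -> x = y.
  rewrite /I/= !in_itv/= => /andP[ax xb] /andP[ay yb] xy.
  by have [/Zlt|/Zlt|//] := ltgtP x y => lt; [move: (lt ax yb)|move: (lt ay xb)]; rewrite xy ltxx.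
(* The default [a] is returned only outside the image of [I] under [Z], hence nowhere on the
   interval []Z c, Z d[] below. *)
pose X z := xget a [set x | I x /\ Z x = z].
have ZK x : I x -> X (Z x) = x.
  move=> Ix; apply: xget_unique => // y [Iy yx]; exact: Zinj.
have dX x : I x -> is_derive (Z x) 1 X (h x).
  move=> Ix; rewrite -[h x]invrK; apply: is_derive_inverse.
  - have : nbhs x I by apply: open_nbhs_nbhs; split => //; exact: itv_open.
    by apply: filterS => y; exact: ZK.
  - have : nbhs x I by apply: open_nbhs_nbhs; split => //; exact: itv_open.
    apply: filterS => y /dZ[dy _]; apply: differentiable_continuous.
    exact/derivable1_diffP.
  - exact: dZ.
  - by rewrite invr_neq0// gt_eqF.
have Ia : I a by rewrite /I/= in_itv/=; apply/andP; split; lra.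
have Ib : I b by rewrite /I/= in_itv/=; apply/andP; split; lra.
have Za : Z a = z0 by rewrite /Z; ring.
(* Half margins: the closed interval [[c, d]] lies inside [I], so the intermediate value theorem
   applies to [Z] on it. *)
pose c := a - 2^-1; pose d := b + 2^-1.
have cd : c <= d by rewrite /c /d; lra.
exists (Z b), X, [set` `]Z c, Z d[]; split.
- by rewrite -Za; apply: Zlt => //; lra.
- by rewrite -Za ZK.
- by rewrite ZK.
split; first exact: itv_open.
  move=> z /=; rewrite !in_itv/= => /andP[az zb]; apply/andP; split.
    by apply: lt_le_trans az; rewrite -Za; apply: Zlt; rewrite /c; lra.
  by apply: le_lt_trans zb _; apply: Zlt; rewrite /d; lra.
move=> z /=; rewrite in_itv/= => /andP[cz zd].
have [x] : exists2 x, x \in `[c, d] & Z x = z.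
  apply: IVT => //.
- apply: derivable_within_continuous => x.
  rewrite in_itv/= => /andP[cx xd]; have [] // := dZ x.
  by rewrite in_itv/=; apply/andP; move: cx xd; rewrite /c /d; split; lra.
- by rewrite ge_min le_max (ltW cz) (ltW zd) orbT.
rewrite in_itv/= => /andP[cx xd] <-.
have Ix : I x by rewrite /I/= in_itv/=; apply/andP; move: cx xd; rewrite /c /d; split; lra.
by rewrite ZK//; exact: dX.
Qed.

(** * Derivation of powers of [X] and [1 + X^2] *)

(** Up to the factor [l], the derivative is a sum of two terms of the original form. For [k = 0] the
    truncated [k.-1] is harmless, since the coefficient [k%:R] vanishes. *)
Lemma is_derive_power {R : realType} (X : R -> R) (z l c al : R) (k : nat) :
  is_derive z 1 X l ->
  is_derive z 1 (fun u => c * X u ^+ k * (1 + X u ^+ 2) `^ al)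
    ((c * k%:R * X z ^+ k.-1 * (1 + X z ^+ 2) `^ al +
      2 * c * al * X z ^+ k.+1 * (1 + X z ^+ 2) `^ (al - 1)) * l).
Proof.
move=> dX.
have X0 : 0 < 1 + X z ^+ 2 by rewrite ltr_pwDl ?sqr_ge0.
have dE : is_derive z 1 (fun u => 1 + X u ^+ 2) (2 * X z * l).
  have := is_deriveD (is_derive_cst (1:R) z (1:R)) (is_deriveX 2 dX).
  by rewrite add0r /= expr1 /GRing.scale/=.
have dp : is_derive z 1 (fun u => (1 + X u ^+ 2) `^ al)
    (al * (1 + X z ^+ 2) `^ (al - 1) * (2 * X z * l)).
  exact: (@is_derive1_comp _ (fun y => y `^ al) (fun u => 1 + X u ^+ 2)
    z _ _ (is_derive1_powR al X0) dE).
have dc : is_derive z 1 (fun u => c * X u ^+ k) (c * (k%:R * X z ^+ k.-1 * l)).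
  have -> : (fun u => c * X u ^+ k) = c \*: (X ^+ k).
    by apply/funext => u; rewrite exprfctE.
  exact: is_derive_eq (is_deriveZ c (is_deriveX k dX)) _.
apply: is_derive_eq (is_deriveM dc dp) _.
by rewrite /GRing.scale/= (exprS _ k); ring.
Qed.

(* Along [X' = nu (1 + X^2)^be] the span of the functions [X^k (1 + X^2)^al] is
   stable under derivation, whence the smoothness of the catenary. *)
Section PowerClass.
Context {R : realType} (X : R -> R).

Inductive power_class : set (R -> R) :=
| power_mono c k al : power_class (fun z => c * X z ^+ k * (1 + X z ^+ 2) `^ al)
| power_add g h : power_class g -> power_class h ->
    power_class (fun z => g z + h z).

Lemma power_class_derive (U : set R) (nu be : R) :
  (forall z, U z -> is_derive z 1 X (nu * (1 + X z ^+ 2) `^ be)) ->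
  forall g, power_class g ->
    exists2 g', power_class g' & forall x, U x -> is_derive x 1 g (g' x).
Proof.
move=> dX g; elim=> [c k al|g1 g2 _ [h1 C1 d1] _ [h2 C2 d2]]; last first.
  exists (fun z => h1 z + h2 z); first exact: power_add.
  by move=> z Uz; apply: is_deriveD; [exact: d1 | exact: d2].
exists (fun z => c * k%:R * nu * X z ^+ k.-1 * (1 + X z ^+ 2) `^ (al + be) +
  2 * c * al * nu * X z ^+ k.+1 * (1 + X z ^+ 2) `^ (al - 1 + be)).
  by apply: power_add; exact: power_mono.
move=> z Uz; apply: is_derive_eq (is_derive_power c al k (dX z Uz)) _.
have X0 : 1 + X z ^+ 2 != 0 by rewrite gt_eqF// ltr_pwDl ?sqr_ge0.
by rewrite !powRD ?X0 ?implybT//; ring.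
Qed.

End PowerClass.

(** * Convexity, power estimates and the choice of [s] *)

(** A value [g z >= 0] inside would give, by the mean value theorem on either side of [z], a point
    [x] with [g1 x >= 0] followed by a point [y] with [g1 y <= 0], although [g1] is strictly
    increasing. *)
Lemma convex_below_chord {R : realType} (g g1 g2 : R -> R) (a b : R) :
  g a = 0 -> g b = 0 ->
  (forall z, z \in `[a, b] -> is_derive z 1 g (g1 z)) ->
  (forall z, z \in `[a, b] -> is_derive z 1 g1 (g2 z)) ->
  (forall z, z \in `[a, b] -> 0 < g2 z) ->
  forall z, z \in `]a, b[ -> g z < 0.
Proof.
move=> ga gb d1 d2 g20 z; rewrite in_itv/= => /andP[az zb].
rewrite ltNge; apply/negP => gz.
have mvt c d : a <= c -> c < d -> d <= b ->
    exists2 x, x \in `]c, d[ & g d - g c = g1 x * (d - c).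
  move=> ac cd db.
  have sub x : x \in `[c, d] -> x \in `[a, b].
    by rewrite !in_itv/= => /andP[cx xd]; rewrite (le_trans ac cx) (le_trans xd db).
  have h1 x : x \in `]c, d[ -> is_derive x 1 g (g1 x).
    by rewrite in_itv/= => /andP[/ltW cx /ltW xd]; apply: d1; apply: sub; rewrite in_itv/= cx.
  have h2 : {within `[c, d], continuous g}.
    by apply: derivable_within_continuous => x /sub /d1[].
  exact: MVT cd h1 h2.
have [x] := mvt a z (lexx a) az (ltW zb).
rewrite in_itv/= => /andP[ax xz] ex.
have [y] := mvt z b (ltW az) zb (lexx b).
rewrite in_itv/= => /andP[zy yb] ey.
have gx : 0 <= g1 x.
  by rewrite -(pmulr_lge0 _ (_ : 0 < z - a)) ?subr_gt0// -ex ga subr0.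
have gy : g1 y <= 0.
  by rewrite -(pmulr_lle0 _ (_ : 0 < b - z)) ?subr_gt0// -ey gb sub0r oppr_le0.
have xy : x < y by exact: lt_trans xz zy.
have sub u : u \in `[x, y] -> u \in `[a, b].
  rewrite !in_itv/= => /andP[xu uy].
  by rewrite (le_trans (ltW ax) xu) (le_trans uy (ltW yb)).
have : g1 x < g1 y.
  apply: (is_derive_lt xy (fun u ui => d2 u (sub u ui))) => u ui.
  by apply: g20; apply: sub; exact: (subset_itv_oo_cc ui).
by rewrite ltNge (le_trans gy gx).
Qed.

(** The difference is [g * c^(g - 1) * (v - u)] for some [c] with [u < c < v]. As [-1 <= g - 1 <= 0]
    and [c >= 1], the power lies between [1 / c], which exceeds [1 / v], and [1]. *)
Lemma powR_diff_bounds {R : realType} (g u v : R) :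
  0 <= g -> g <= 1 -> 1 <= u -> u < v ->
  g * (v - u) / v <= v `^ g - u `^ g <= g * (v - u).
Proof.
move=> g0 g1 u1 uv.
have pos x : u <= x -> 0 < x by move=> ux; rewrite (lt_le_trans _ (le_trans u1 ux)).
have d x : u <= x -> is_derive x 1 (@powR R ^~ g) (g * x `^ (g - 1)).
  by move=> /pos; exact: is_derive1_powR.
pose dp x := g * x `^ (g - 1).
have h1 x : x \in `]u, v[ -> is_derive x 1 (@powR R ^~ g) (dp x).
  by rewrite in_itv/= => /andP[/ltW ux _]; exact: d.
have h2 : {within `[u, v], continuous (@powR R ^~ g)}.
  apply: derivable_within_continuous => x.
  by rewrite in_itv/= => /andP[/d[]].
have [c] := MVT uv h1 h2; rewrite /dp in_itv/= => /andP[uc cv] ->.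
have vu : 0 <= v - u by rewrite subr_ge0 ltW.
have c0 := pos c (ltW uc); have v0 := lt_trans c0 cv.
have c1 : 1 <= c by rewrite (le_trans u1 (ltW uc)).
apply/andP; split; last first.
  by rewrite ler_wpM2r// ler_piMr// -[leRHS](powRr0 c) ler_powR// subr_le0.
rewrite mulrAC ler_wpM2r// ler_wpM2l//.
apply: (@le_trans _ _ c^-1); first by rewrite lef_pV2 ?posrE// ltW.
by rewrite -(powR_inv1 (ltW c0)) ler_powR// lerBrDl addrN.
Qed.

(** At [s = 0] one has [p = q = t], and every condition but [0 < s] holds strictly; by continuity
    they persist for small positive [s]. The bound on [1 + p^2] serves to prove [s < 2 * m]; the
    last three keep the slope of the support below [1] and [1 / t], and its second derivative below
    that of the catenary. *)
Lemma small_contact_slope {R : realType} (t : R) : 0 < t ->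
  exists s : R, let p := (s + t) / (1 - s * t) in let q := (t - s) / (1 + s * t) in
  [/\ 0 < s, s < t, s * t < 1, 1 + p ^+ 2 < 2 * (1 + t ^+ 2) &
    [/\ (p - q) * (1 + p ^+ 2) < 1, t * ((p - q) * (1 + p ^+ 2)) < 1 &
      ((p - q) * (1 + p ^+ 2) / 2 + s) * (8 * (1 + p ^+ 2)) < t]].
Proof.
move=> t0.
pose p s := (s + t) / (1 - s * t); pose q s := (t - s) / (1 + s * t).
have cst (c : R) : {for 0, continuous (fun _ : R => c)} by apply: cvg_cst.
have cid : {for 0, continuous (fun x : R => x)} by exact: cvg_id.
have cp : {for 0, continuous p}.
  apply: continuousM; first by apply: continuousD.
  apply: continuousV; first by rewrite mul0r subr0 oner_neq0.
  by apply: continuousB => //; apply: continuousM.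
have cq : {for 0, continuous q}.
  apply: continuousM; first by apply: continuousB.
  apply: continuousV; first by rewrite mul0r addr0 oner_neq0.
  by apply: continuousD => //; apply: continuousM.
have p0 : p 0 = t by rewrite /p; field.
have q0 : q 0 = t by rewrite /q; field.
have cpp : {for 0, continuous (fun s => 1 + p s ^+ 2)}.
  have -> : (fun s => 1 + p s ^+ 2) = (fun s => 1 + p s * p s).
    by apply/funext => s; rewrite expr2.
  by apply: continuousD => //; apply: continuousM.
have cpq : {for 0, continuous (fun s => (p s - q s) * (1 + p s ^+ 2))}.
  by apply: continuousM => //; apply: continuousB.
have near_lt (F : R -> R) (c : R) : {for 0, continuous F} -> F 0 < c ->
    \forall s \near 0^'+, F s < c.
  by move=> cF; apply: cvgr_lt; exact: cvg_at_right_filter.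
near (0:R)^'+ => s; exists s => /=; rewrite -/(p s) -/(q s); split.
- by near: s; exact: nbhs_right_gt.
- by near: s; exact: nbhs_right_lt.
- near: s; apply: (near_lt (fun s => s * t)); last by rewrite mul0r.
  by apply: continuousM.
- by near: s; apply: (near_lt _ _ cpp); rewrite p0; nra.
split; near: s.
- by apply: (near_lt _ _ cpq); rewrite p0 q0 subrr mul0r.
- apply: (near_lt (fun s => t * _)); last by rewrite p0 q0 subrr mul0r mulr0.
  by apply: continuousM.
- apply: (near_lt (fun s => (_ / 2 + s) * (8 * _))).
    by do !apply: continuousM => //; apply: continuousD => //; apply: continuousM.
  by rewrite p0 q0 subrr !mul0r addr0 mul0r.
Unshelve. all: by end_near. Qed.

(** * Catenaries parametrised by their slope *)

(* The slope [X] of the catenary [f = (1 + X^2)^gam] solves an autonomous equation. *)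
Lemma catenary_arc {R : realType} (n : nat) (z0 a b : R) : (2 <= n)%N -> a < b ->
  let nu := n.-1%:R : R in let gam := (2 * nu)^-1 in
  exists z1 (f X : R -> R),
    [/\ z0 < z1, X z0 = a, X z1 = b, smooth_on [set` `[z0, z1]] f &
      forall z, z \in `[z0, z1] ->
      [/\ f z = (1 + X z ^+ 2) `^ gam, a <= X z <= b,
          is_derive z 1 f (X z),
          is_derive z 1 X (nu * (1 + X z ^+ 2) `^ (1 - gam)) &
          derive1n 2 f z = nu * (1 + X z ^+ 2) `^ (1 - gam)]].
Proof.
move=> hn ab nu gam.
have nu0 : 0 < nu by rewrite ltr0n; case: n hn @nu @gam => [//|[]].
have E0 x : 0 < 1 + x ^+ 2 :> R by rewrite ltr_pwDl ?sqr_ge0.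
pose h x := nu * (1 + x ^+ 2) `^ (1 - gam).
have dh (x : R) : is_derive x 1 h ((nu * 0%:R * x ^+ 0.-1 * (1 + x ^+ 2) `^ (1 - gam) +
      2 * nu * (1 - gam) * x ^+ 1 * (1 + x ^+ 2) `^ (1 - gam - 1)) * 1).
  have -> : h = (fun x => nu * id x ^+ 0 * (1 + id x ^+ 2) `^ (1 - gam)).
    by apply/funext => y; rewrite expr0 mulr1.
  exact: is_derive_power (is_derive_id x 1).
have ch : continuous h.
  by move=> x; apply: differentiable_continuous; apply/derivable1_diffP; case: (dh x).
have h0 x : 0 < h x by rewrite mulr_gt0// powR_gt0.
have [z1 [X [U [z01 X0 X1 [oU ZU dX]]]]] := autonomous_ode_crossing z0 ch h0 ab.
pose f z := (1 + X z ^+ 2) `^ gam.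
(* The chain rule gives [f' = 2 * gam * nu * X]; this value of [gam] is the one that makes [X] the
   slope of [f]. *)
have df z : U z -> is_derive z 1 f (X z).
  move=> Uz; have := is_derive_power 1 gam 0 (dX z Uz).
  have -> : (fun u => 1 * X u ^+ 0 * (1 + X u ^+ 2) `^ gam) = f.
    by apply/funext => y; rewrite expr0 !mul1r.
  move=> d; apply: is_derive_eq d _.
  have := E0 (X z); rewrite /h; set E := 1 + _ => E1.
  have e : E `^ (gam - 1) * E `^ (1 - gam) = 1.
    by rewrite -powRD ?(gt_eqF E1) ?implybT// addrA subrK subrr powRr0.
  transitivity (2 * (gam * nu) * X z * (E `^ (gam - 1) * E `^ (1 - gam))); first by ring.
  by rewrite e /gam; field; rewrite gt_eqF.
exists z1, f, X; split => //.
  apply: (smooth_on_class oU ZU (power_class_derive dX)).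
  have -> : f = (fun u => 1 * X u ^+ 0 * (1 + X u ^+ 2) `^ gam).
    by apply/funext => y; rewrite expr0 !mul1r.
  exact: power_mono.
move=> z zI; have Uz := ZU z zI.
split=> //; [|exact: df|exact: dX|].
  move: zI; rewrite in_itv/= => /andP[z0z zz1].
  have mono x y : z0 <= x -> x <= y -> y <= z1 -> X x <= X y.
    move=> z0x; rewrite le_eqVlt => /orP[/eqP -> //|xy] yz1.
    pose Y u := h (X u).
    have d u : u \in `[x, y] -> is_derive u 1 X (Y u).
      rewrite in_itv/= => /andP[xu uy]; apply: dX; apply: ZU => /=.
      by rewrite in_itv/= (le_trans z0x xu) (le_trans uy yz1).
    by apply/ltW/(is_derive_lt xy d) => u _; exact: h0.
  by rewrite -{1}X0 -X1 !mono.
rewrite derive1nS; apply: is_derive_derive1.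
apply: near_eq_is_derive (dX z Uz).
near=> u; apply/esym/is_derive_derive1/df; near: u; exact: open_nbhs_nbhs.
Unshelve. all: by end_near. Qed.

(** * Lines perturbed by a sine *)

(** The summand [0 * z] is kept so that the derivative has the shape of the function itself, with
    coefficients [be], [0], [- (de * k)], [ga * k]; this shape is then stable under derivation. *)
Lemma is_derive_sine_line {R : realType} (al be ga de k z0 z : R) :
  is_derive z 1
    (fun u => al + be * u + ga * sin (k * (u - z0)) + de * cos (k * (u - z0)))
    (be + 0 * z - de * k * sin (k * (z - z0)) + ga * k * cos (k * (z - z0))).
Proof.
have da : is_derive z 1 (fun u => k * (u - z0)) k.
  have := is_deriveZ k (is_deriveB (is_derive_id z 1) (is_derive_cst z0 z 1)).
  by rewrite subr0 [_ *: _]mulr1.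
have ds := is_derive1_comp (f := sin) (is_derive_sin _) da.
have dc := is_derive1_comp (f := cos) (is_derive_cos _) da.
have := is_deriveD (is_deriveD (is_deriveD (is_derive_cst al z (1:R))
  (is_deriveZ be (is_derive_id z (1:R)))) (is_deriveZ ga ds)) (is_deriveZ de dc).
by move=> d; apply: is_derive_eq d _; rewrite /GRing.scale/=; ring.
Qed.

Lemma smooth_sine_line {R : realType} (D : set R) (al be ga de k z0 : R) :
  smooth_on D
    (fun u => al + be * u + ga * sin (k * (u - z0)) + de * cos (k * (u - z0))).
Proof.
pose C := [set g : R -> R | exists al be ga de, g =
  (fun u => al + be * u + ga * sin (k * (u - z0)) + de * cos (k * (u - z0)))].
apply: (@smooth_on_class R C setT) => //; first exact: openT.
- move=> _ [al1 [be1 [ga1 [de1 ->]]]]; eexists; last first.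
    by move=> x _; exact: is_derive_sine_line.
  exists be1, 0, (- (de1 * k)), (ga1 * k).
  by apply/funext => u; rewrite mulNr.
- by exists al, be, ga, de.
Qed.

(** * Properness and completeness over an infinite height range *)

Lemma smooth_on_continuous {R : realType} (D : set R) (g : R -> R) (k : nat) (x : R) :
  smooth_on D g -> D x -> {for x, continuous (derive1n k g)}.
Proof.
move=> [U _ [DU dU]] /DU Ux.
by apply: differentiable_continuous; apply/derivable1_diffP; exact: dU.
Qed.

(** The height is a coordinate of the meridian, so the curve leaves every bounded set whatever [rho]
    is. *)
Lemma proper_meridian_pinfty {R : realType} (rho : R -> R) :
  proper_meridian +oo%E rho.
Proof.
move=> K /compact_bounded[M [Mr KM]].
pose z0 := Num.max 0 (M + 1) + 1.
have z0P : 0 <= z0 by rewrite /z0 addr_ge0// le_max lexx.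
have z0M : M + 1 < z0 by rewrite /z0 (@le_lt_trans _ _ (Num.max 0 (M + 1))) ?ltrDl// le_max lexx orbT.
exists z0; first by split=> //; rewrite ltry.
move=> z _ z0z Kz.
have := KM (M + 1) _ _ Kz; rewrite ltrDl ltr01 => /(_ isT).
rewrite /= prod_normE/= ge_max => /andP[_].
rewrite ger0_norm ?(le_trans z0P z0z)// leNgt => /negP; apply.
exact: lt_le_trans z0M z0z.
Qed.

(** The speed is at least [1] and the half-line has infinite measure; smoothness makes the speed
    measurable. *)
Lemma complete_meridian_pinfty {R : realType} (rho : R -> R) :
  smooth_on (heights +oo%E) rho -> complete_meridian +oo%E rho.
Proof.
move=> srho.
have hE : heights (+oo%E : \bar R) = [set` `[0, +oo[%R].
  apply/seteqP; split => z /=; rewrite in_itv/= ?andbT; first by case.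
  by move=> z0; split => //; rewrite ltry.
apply/eqP; rewrite -leye_eq /complete_meridian hE.
have <- : (\int[lebesgue_measure]_(z in [set` `[0%R, +oo[]) (cst 1%:E z) = +oo :> \bar R)%E.
  by rewrite integral_cst//= mul1e lebesgue_measure_itv /= ltry.
apply: ge0_le_integral => //.
- apply/measurable_EFinP.
  apply: (subspace_continuous_measurable_fun) => //.
  apply: continuous_in_subspaceT => z /set_mem; rewrite -hE => hz.
  have c1 := @smooth_on_continuous R _ _ 1 z srho hz.
  apply: (@continuous_comp _ _ _ (fun z => 1 + derive1 rho z ^+ 2) Num.sqrt); last exact: sqrt_continuous.
  apply: continuousD; first exact: cvg_cst.
  have -> : (fun z => derive1 rho z ^+ 2) = (fun z => derive1 rho z * derive1 rho z).
    by apply/funext => y; rewrite expr2.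
  exact: continuousM.
- by move=> z _ /=; rewrite lee_fin -{1}sqrtr1 ler_wsqrtr// lerDl sqr_ge0.
Qed.

(** * The Euclidean norm and the interior of the body *)

Lemma enormZ {R : realType} (n : nat) (c : R) (y : 'rV[R]_n) :
  enorm (c *: y) = `|c| * enorm y.
Proof.
rewrite /enorm; under eq_bigr do rewrite mxE exprMn.
by rewrite -mulr_sumr sqrtrM ?sqr_ge0// sqrtr_sqr.
Qed.

Lemma enorm_continuous {R : realType} (n : nat) : continuous (@enorm R n).
Proof.
move=> y; apply: (@continuous_comp _ _ _
  (fun y : 'rV[R]_n => \sum_i y ord0 i ^+ 2) Num.sqrt); last exact: sqrt_continuous.
apply: continuous_big => [|i _ v]; first exact: add_continuous.
have -> : (fun y : 'rV[R]_n => y ord0 i ^+ 2) = (fun y => y ord0 i * y ord0 i).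
  by apply/funext => u; rewrite expr2.
by apply: continuousM; exact: coord_continuous.
Qed.

Lemma body_interior {R : realType} (n : nat) (rho : R -> R) (y : 'rV[R]_n) (z : R) :
  0 < z -> {for z, continuous rho} -> enorm y < rho z ->
  (body n +oo%E rho)° (y, z).
Proof.
move=> z0 crho yz.
have c2 : {for (y, z), continuous (fun p : 'rV[R]_n * R => p.2)} by exact: cvg_snd.
have c1 : {for (y, z), continuous (fun p : 'rV[R]_n * R => enorm p.1)}.
  by apply: (@continuous_comp _ _ _ fst); [exact: cvg_fst|exact: enorm_continuous].
have cr : {for (y, z), continuous (fun p : 'rV[R]_n * R => rho p.2)}.
  exact: (@continuous_comp _ _ _ snd).
have cd : {for (y, z), continuous (fun p : 'rV[R]_n * R => rho p.2 - enorm p.1)}.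
  exact: continuousB.
rewrite /interior; near=> p; split; first split.
- by apply/ltW; near: p; exact: (cvgr_gt _ c2).
- exact: ltry.
- by apply/ltW; rewrite -subr_gt0; near: p; apply: (cvgr_gt _ cd); rewrite subr_gt0.
Unshelve. all: by end_near. Qed.

(** * Contact angles, catenary band and support profile *)

(** Both angles lie in []0, pi / 2[], so their difference stays in the range on which [atan] inverts
    [tan]. *)
Lemma atanB {R : realType} (x y : R) : 0 < x -> 0 < y ->
  atan x - atan y = atan ((x - y) / (1 + x * y)).
Proof.
move=> x0 y0.
have ax := atan_ltpi2 x; have ay := atan_ltpi2 y.
have ax0 : 0 < atan x by rewrite -(atan0 R) lt_atan.
have ay0 : 0 < atan y by rewrite -(atan0 R) lt_atan.
rewrite -[LHS]tanK; last by rewrite in_itv/=; apply/andP; split; lra.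
have cos_ne0 z : cos (atan z) != 0.
  by rewrite gt_eqF// cos_gt0_pihalf// atan_gtNpi2 atan_ltpi2.
rewrite tanD ?cosN ?cos_ne0// tanN !atanK.
by rewrite mulrN opprK.
Qed.

(** Since [|X| <= p], the derivative of [X] lies between [nu] and [nu * (1 + p^2)], whence
    [nu * l <= p + q <= nu * (1 + p^2) * l]. The rise of [f] is a difference of powers [gam] of
    [1 + p^2] and [1 + q^2], numbers that differ by [(p - q) * (p + q)]; as [gam = 1 / (2 * nu)],
    the bounds on [p + q] bracket the mean slope. *)
Lemma catenary_chord {R : realType} (n : nat) (p q : R) : (2 <= n)%N ->
  0 < q -> q < p ->
  let nu := n.-1%:R : R in
  exists l (f X Y : R -> R),
    [/\ 0 < l, X 1 = - q, X (1 + l) = p, smooth_on [set` `[1, 1 + l]] f &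
    [/\ forall z, z \in `[1, 1 + l] ->
          [/\ is_derive z 1 f (X z), is_derive z 1 X (Y z),
              derive1n 2 f z = Y z & nu <= Y z],
        forall z, z \in `[1, 1 + l] ->
          [/\ 1 <= f z, f z * Y z = nu * (1 + X z ^+ 2) &
              f z ^+ n.-1 = Num.sqrt (1 + X z ^+ 2)],
        p + q <= nu * (1 + p ^+ 2) * l &
        (p - q) / (2 * (1 + p ^+ 2)) <= (f (1 + l) - f 1) / l
          <= (p - q) * (1 + p ^+ 2) / 2]].
Proof.
move=> hn q0 qp nu.
have p0 : 0 < p := lt_trans q0 qp.
have nu1 : 1 <= nu by rewrite ler1n; case: n hn @nu => [//|[]].
have nu0 : 0 < nu := lt_le_trans ltr01 nu1.
have qp' : - q < p by lra.
have := @catenary_arc R n 1 (- q) p hn qp'; rewrite -/nu.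
set gam := (2 * nu)^-1 => -[z1 [f [X [z01 X0 X1 sf fX]]]].
have gam0 : 0 < gam by rewrite invr_gt0 mulr_gt0.
have gam1 : gam <= 1 by rewrite invf_le1 ?mulr_gt0//; lra.
pose l := z1 - 1; have l0 : 0 < l by rewrite subr_gt0.
have z1E : 1 + l = z1 by rewrite /l; ring.
pose Y z := nu * (1 + X z ^+ 2) `^ (1 - gam).
have E1 x : 1 <= 1 + x ^+ 2 :> R by rewrite lerDl sqr_ge0.
have E0 x : 0 < 1 + x ^+ 2 :> R by exact: lt_le_trans (E1 x).
have Yge z : nu <= Y z.
  rewrite ler_peMr ?(ltW nu0)// -[leLHS](powRr0 (1 + X z ^+ 2)) ler_powR//; lra.
have Yle z : z \in `[1, z1] -> Y z <= nu * (1 + p ^+ 2).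
  move=> /fX[_ /andP[Xq Xp] _ _ _]; rewrite ler_wpM2l ?(ltW nu0)//.
  apply: (@le_trans _ _ (1 + X z ^+ 2)); last by rewrite lerD2l; nra.
  rewrite -[leRHS](powRr1 (ltW (E0 _))) ler_powR//; lra.
have sub z : z \in `]1, z1[ -> z \in `[1, z1].
  by rewrite !in_itv/= => /andP[/ltW -> /ltW ->].
have [c cI cE] : exists2 c, c \in `]1, z1[ & X z1 - X 1 = Y c * (z1 - 1).
  have h1 z : z \in `]1, z1[ -> is_derive z 1 X (Y z) by move=> /sub /fX[].
  have h2 : {within `[1, z1], continuous X}.
    by apply: derivable_within_continuous => z /fX[_ _ _ [+ _] _].
  exact: MVT z01 h1 h2.
have lb : nu * l <= p + q.
  move: cE; rewrite X0 X1 opprK -/l => ->.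
  by rewrite ler_wpM2r// ltW.
have ub : p + q <= nu * (1 + p ^+ 2) * l.
  move: cE; rewrite X0 X1 opprK -/l => ->.
  by rewrite ler_wpM2r ?(ltW l0)// Yle// sub.
exists l, f, X, Y; rewrite z1E; split => //; split => //.
- by move=> z /fX[_ _ dX dY eY]; split.
- move=> z /fX[fE _ _ _ _]; rewrite fE; split.
  + by rewrite -[leLHS](powRr0 (1 + X z ^+ 2)) ler_powR// ltW.
  + rewrite /Y mulrCA -powRD; last by rewrite (gt_eqF (E0 _)) implybT.
    by rewrite (_ : gam + _ = 1) ?powRr1// ?(ltW (E0 _))//; ring.
  (* The square root appears because [gam * nu = 1 / 2]. *)
  + rewrite -powR_mulrn ?powR_ge0// -powRrM -powR12_sqrt ?(ltW (E0 _))//; congr (_ `^ _).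
    by rewrite -/nu; field; rewrite gt_eqF.
have e1 : 1 \in `[1, z1] by rewrite in_itv/= lexx ltW.
have e2 : z1 \in `[1, z1] by rewrite in_itv/= lexx ltW.
have [f1 _ _ _ _] := fX _ e1; have [f2 _ _ _ _] := fX _ e2.
rewrite f1 f2 X0 X1 sqrrN.
have pq : 1 + q ^+ 2 < 1 + p ^+ 2 by rewrite ltrD2l; nra.
have /andP[lo hi] := powR_diff_bounds (ltW gam0) gam1 (E1 q) pq.
set D := _ `^ gam - _ `^ gam in lo hi *.
have dpq : 1 + p ^+ 2 - (1 + q ^+ 2) = (p - q) * (p + q) by ring.
rewrite dpq in lo hi.
have pq0 : 0 < p - q by rewrite subr_gt0.
apply/andP; split.
  rewrite ler_pdivlMr//; apply: le_trans lo.
  rewrite -(@ler_pM2l _ (2 * nu * (1 + p ^+ 2))) ?mulr_gt0//.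
  rewrite [leLHS](_ : _ = (p - q) * (nu * l)); last first.
    by field; rewrite gt_eqF.
  rewrite [leRHS](_ : _ = (p - q) * (p + q)); last first.
    by rewrite /gam; field; rewrite !gt_eqF.
  by rewrite ler_pM2l.
rewrite ler_pdivrMr//; apply: (le_trans hi).
rewrite -(@ler_pM2l _ (2 * nu)) ?mulr_gt0//.
rewrite [leLHS](_ : _ = (p - q) * (p + q)); last first.
  by rewrite /gam; field; rewrite gt_eqF.
rewrite [leRHS](_ : _ = (p - q) * (nu * (1 + p ^+ 2) * l)); last by field.
by rewrite ler_pM2l.
Qed.

(** The slope runs through exactly one period of a cosine over the band, so it starts and ends at
    [s] and averages to [m]. The sign of [m - s] is left open, hence the minimum, maximum and
    absolute value. *)
Lemma sine_profile {R : realType} (c m s l : R) : 0 < l ->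
  exists rho r1 r2 : R -> R,
    [/\ forall D, smooth_on D rho,
        forall z : R, is_derive z 1 rho (r1 z) /\ is_derive z 1 r1 (r2 z),
        rho 1 = c /\ rho (1 + l) = c + m * l,
        r1 1 = s /\ r1 (1 + l) = s &
        forall z, [/\ Num.min s (2 * m - s) <= r1 z,
          r1 z <= Num.max s (2 * m - s) & r2 z * l <= `|m - s| * (2 * pi)]].
Proof.
move=> l0; pose k := 2 * pi / l.
have p0 : 0 < pi :> R by exact: pi_gt0.
have k0 : 0 < k by rewrite divr_gt0// mulr_gt0.
(* The constant [c - m] gives [rho 1 = c]; the zero coefficients here and in [r1] match the form of
   [is_derive_sine_line]. *)
pose rho u := (c - m) + m * u + (- (m - s) / k) * sin (k * (u - 1)) +
  0 * cos (k * (u - 1)).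
pose r1 u := m + 0 * u + 0 * sin (k * (u - 1)) + (- (m - s)) * cos (k * (u - 1)).
pose r2 u := (m - s) * k * sin (k * (u - 1)).
have kl : k * (1 + l - 1) = pi *+ 2.
  by rewrite /k mulr2n; field; rewrite gt_eqF.
have k1 : k * (1 - 1) = 0 :> R by rewrite subrr mulr0.
exists rho, r1, r2; split.
- by move=> D; exact: smooth_sine_line.
- move=> z; split.
    apply: is_derive_eq (is_derive_sine_line _ _ _ _ _ _ _) _.
    by rewrite /r1; field; rewrite gt_eqF.
  apply: is_derive_eq (is_derive_sine_line _ _ _ _ _ _ _) _.
  by rewrite /r2; ring.
- by split; rewrite /rho ?kl ?k1 ?sin2pi ?sin0; ring.
- by split; rewrite /r1 ?kl ?k1 ?cos2pi ?cos0; ring.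
move=> z; set a := k * (z - 1).
(* The slope is a convex combination of its two extreme values. *)
have r1E : r1 z = (1 - cos a) / 2 * (2 * m - s) + (1 + cos a) / 2 * s.
  by rewrite /r1 -/a; field.
have := cos_geN1 a; have := cos_le1 a => ca1 ca2.
have c1 : 0 <= (1 - cos a) / 2 by rewrite divr_ge0// subr_ge0.
have c2 : 0 <= (1 + cos a) / 2 by rewrite divr_ge0// -lerBlDl sub0r.
split.
- rewrite r1E.
  set u := Num.min _ _.
  have us : u <= s by rewrite ge_min lexx.
  have um : u <= 2 * m - s by rewrite ge_min lexx orbT.
  have -> : u = (1 - cos a) / 2 * u + (1 + cos a) / 2 * u by field.
  by rewrite lerD// ler_wpM2l.
- rewrite r1E.
  set u := Num.max _ _.
  have us : s <= u by rewrite le_max lexx.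
  have um : 2 * m - s <= u by rewrite le_max lexx orbT.
  have -> : u = (1 - cos a) / 2 * u + (1 + cos a) / 2 * u by field.
  by rewrite lerD// ler_wpM2l.
- have -> : r2 z * l = (m - s) * sin a * (2 * pi).
    by rewrite /r2 -/a /k; field; rewrite gt_eqF.
  rewrite ler_wpM2r ?mulr_ge0 ?(ltW p0)//.
  apply: le_trans (ler_norm _) _; rewrite normrM ler_piMr//.
  by rewrite ler_norml sin_geN1 sin_le1.
Qed.

(** * Choice of the parameters and verification of the band *)

Theorem propositionA1 (R : realType) (n : nat) (theta : R)
    (hn : (2 <= n)%N) (htheta1 : pi / 2 < theta) (htheta2 : theta < pi) :
  exists rho : R -> R,
    [/\ one_ended_support +oo%E rho,
        no_cylindrical_interval +oo%E rho,
        (forall z : R, 0 <= z -> 0 < derive1 rho z < - cot theta) &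
        exists (Sigma : set ('rV[R]_n * R)) (a b : R),
          admissible_band +oo%E rho theta Sigma a b /\
          Atheta n rho theta b = Btheta n rho theta a].
Proof.
pose phi : R := pi - theta.
have phi0 : 0 < phi by rewrite subr_gt0.
have phi2 : phi < pi / 2 by rewrite /phi; lra.
pose t := tan phi.
have tphi : atan t = phi.
  by rewrite tanK// in_itv/= phi2 andbT (lt_trans _ phi0)// oppr_lt0 divr_gt0 ?pi_gt0.
have tan_theta : tan theta = - t.
  by rewrite /t /phi addrC tanDpi tanN opprK.
have cphi : 0 < cos phi.
  by apply: cos_gt0_pihalf; rewrite phi2 andbT (lt_trans _ phi0)// oppr_lt0 divr_gt0 ?pi_gt0.
have sphi : 0 < sin phi by apply: sin_gt0_pihalf; rewrite phi0.
have t0 : 0 < t by rewrite divr_gt0.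
have cot_theta : - cot theta = t^-1.
  have -> : theta = - phi + pi by rewrite /phi; ring.
  by rewrite /cot /t /tan cosDpi sinDpi cosN sinN opprK invf_div mulNr opprK.
clearbody t.
have [s] := small_contact_slope t0.
set p := (s + t) / (1 - s * t); set q := (t - s) / (1 + s * t).
move=> [s0 st st1 p2 [pq1 tpq1 pqs]].
have st0 : 0 < s * t by rewrite mulr_gt0.
have D1 : 0 < 1 - s * t by rewrite subr_gt0.
have D2 : 0 < 1 + s * t by rewrite addr_gt0.
have q0 : 0 < q by rewrite divr_gt0// subr_gt0.
have tp : t < p by rewrite /p ltr_pdivlMr//; nra.
have qt : q < t by rewrite /q ltr_pdivrMr//; nra.
have qp : q < p := lt_trans qt tp.
have p0 : 0 < p := lt_trans t0 tp.
have [l [f [X [Y [l0 X1 X2 sf [df fE ub]]]]]] := catenary_chord hn q0 qp.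
set m := (_ / l) => /andP[mlo mhi].
have pqE : p - q = 2 * s * (1 + t ^+ 2) / ((1 - s * t) * (1 + s * t)).
  by rewrite /p /q; field; rewrite !gt_eqF.
have E0 x : 0 < 1 + x ^+ 2 :> R by rewrite ltr_pwDl ?sqr_ge0.
(* This makes the extreme slope [2 * m - s] positive. It follows from the lower bound on [m],
   because [p - q > 2 * s * (1 + t^2)] and [1 + p^2 < 2 * (1 + t^2)]. *)
have sm : s < 2 * m.
  have : s < (p - q) / (1 + p ^+ 2).
    rewrite pqE ltr_pdivlMr// ltr_pdivlMr ?mulr_gt0//.
    apply: (@lt_le_trans _ _ (s * (2 * (1 + t ^+ 2)) * 1)); last first.
      by rewrite (_ : 2 * s * _ = s * (2 * (1 + t ^+ 2)) * 1)//; ring.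
    rewrite ltr_pM ?mulr_ge0 ?ltW//.
      by rewrite ltr_pM2l.
    by have := mulr_gt0 st0 st0; lra.
  have -> : (p - q) / (1 + p ^+ 2) = 2 * ((p - q) / (2 * (1 + p ^+ 2))).
    by field; rewrite gt_eqF.
  by move=> h; apply: (lt_le_trans h); rewrite ler_pM2l.
(* These two bounds keep the slope of the support below [1], for the positivity of [rho] under the
   band, and below [1 / t], which is [- cot theta]. *)
have m1 : 2 * m < 1 by move: mhi pq1; lra.
have mt : 2 * m * t < 1.
  apply: le_lt_trans tpq1; rewrite mulrC ler_pM2l//; lra.
have [rho [r1 [r2 [srho drho [rho1 rhol] [r11 r1l] rb]]]] :=
  sine_profile (f 1) m s l0.
have rhol' : rho (1 + l) = f (1 + l).
  by rewrite rhol /m divfK ?gt_eqF// addrC subrK.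
have r1_gt0 z : 0 < r1 z.
  by have [+ _ _] := rb z; apply: lt_le_trans; rewrite lt_min s0 subr_gt0.
have r1_lt1 z : r1 z < 1.
  have [_ + _] := rb z; move=> /le_lt_trans; apply.
  by rewrite gt_max; apply/andP; split; lra.
have r1_ltt z : r1 z < t^-1.
  have [_ + _] := rb z; move=> /le_lt_trans; apply.
  have bt : (2 * m - s) * t < 1 by lra.
  by rewrite -div1r gt_max !ltr_pdivlMr// st1 bt.
have drhoE z : derive1 rho z = r1 z by apply: is_derive_derive1; case: (drho z).
have e1 : 1 \in `[1, 1 + l] by rewrite in_itv/= lexx lerDl ltW.
have e2 : 1 + l \in `[1, 1 + l] by rewrite in_itv/= lexx lerDl ltW.
have f1 : 1 <= f 1 by case: (fE 1 e1).
have rho_gt0 z : 0 <= z -> 0 < rho z.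
  move=> z0; have [z1|z1|->] := ltgtP z 1; last first.
  - by rewrite rho1 (lt_le_trans _ f1).
  - have d u : u \in `[1, z] -> is_derive u 1 rho (r1 u) by case: (drho u).
    have := is_derive_lt z1 d (fun u _ => r1_gt0 u).
    by rewrite rho1; apply: lt_trans; exact: lt_le_trans f1.
  (* Below height [1], a slope less than [1] and [rho 1 >= 1] give [rho z > z]. *)
  - pose r3 u := 1 - r1 u.
    have d u : u \in `[z, 1] -> is_derive u 1 (fun v => v - rho v) (r3 u).
      by move=> _; apply: is_deriveB; case: (drho u).
    have r30 u : u \in `]z, 1[ -> 0 < r3 u by move=> _; rewrite subr_gt0.
    by have := is_derive_lt z1 d r30; rewrite rho1; lra.
have crho z : {for z, continuous rho}.
  by apply: differentiable_continuous; apply/derivable1_diffP; case: (drho z) => -[].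
have below z : z \in `]1, 1 + l[ -> f z < rho z.
  move=> zI; rewrite -subr_lt0.
  pose g1 u := X u - r1 u; pose g2 u := Y u - r2 u.
  apply: (@convex_below_chord R (fun u => f u - rho u) g1 g2 1 (1 + l)) => //.
  - by rewrite rho1 subrr.
  - by rewrite rhol' subrr.
  - by move=> u /df[d _ _ _]; apply: is_deriveB => //; case: (drho u).
  - by move=> u /df[_ d _ _]; apply: is_deriveB => //; case: (drho u).
  (* It remains to see [r2 u < nu]. After multiplication by [l * (1 + p^2)] the left side is at most
     [(m + s) * (8 * (1 + p^2))], where [8] bounds [2 * pi]; this is less than [t], and
     [t < p + q <= nu * (1 + p^2) * l]. *)
  move=> u /df[_ _ _ Yu]; rewrite subr_gt0; apply: lt_le_trans Yu.
  have [_ _ r2u] := rb u.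
  rewrite -(ltr_pM2r l0); apply: le_lt_trans r2u _.
  have ms : `|m - s| <= m + s by rewrite ler_norml; apply/andP; split; lra.
  have pi4 : 2 * pi < 8 :> R by have := @pihalf_lt2 R; lra.
  rewrite -(ltr_pM2r (E0 p)) [ltRHS]mulrAC; apply: lt_le_trans ub.
  apply: (@le_lt_trans _ _ ((m + s) * (8 * (1 + p ^+ 2)))).
    rewrite -mulrA ler_pM ?mulr_ge0 ?pi_ge0 ?(ltW (E0 _))//.
    by rewrite ler_pM2r// ltW.
  apply: (@le_lt_trans _ _ (((p - q) * (1 + p ^+ 2) / 2 + s) * (8 * (1 + p ^+ 2)))).
    by rewrite ler_pM2r ?mulr_gt0// lerD2r.
  by apply: (lt_trans pqs); rewrite (lt_trans tp)// ltrDl.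
(* The relation [atan p = atan s + phi] is solved for [s], which turns it into a difference of
   arctangents of positive numbers, as [atanB] requires. *)
have ps : (p - t) / (1 + p * t) = s.
  have pE : p * (1 - s * t) = s + t by rewrite divfK ?gt_eqF.
  by apply: (canLR (mulfK _)); [rewrite gt_eqF// addr_gt0// mulr_gt0 | lra].
have atan_p : atan s - atan p = - phi.
  by rewrite -ps -atanB// tphi; ring.
have atan_q : atan s - atan (- q) = phi.
  rewrite (_ : - q = (s - t) / (1 + s * t)); last by rewrite /q -mulNr opprB.
  by rewrite -atanB// tphi; ring.
have in_heights (z : R) : 0 <= z -> heights +oo%E z by move=> z0; split=> //; exact: ltry.
exists rho; split.
- split=> //.
  + by move=> z [z0 _]; exact: rho_gt0.
  + exact: proper_meridian_pinfty.
  + exact: complete_meridian_pinfty.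
- move=> c d cd _ /(_ c); rewrite in_itv/= lexx (ltW cd) drhoE => /(_ isT) e.
  by have := r1_gt0 c; rewrite e ltxx.
- by move=> z z0; rewrite drhoE r1_gt0 cot_theta r1_ltt.
exists (rot_hypersurface n f [set` `[1, 1 + l]]), 1, (1 + l); split; last first.
  have [_ _ fa] := fE _ e1; have [_ _ fb] := fE _ e2.
  rewrite /Atheta /Btheta /speed !drhoE r11 r1l rho1 rhol' fa fb X1 X2 tan_theta.
  congr (_ / _); rewrite sqrrN.
  (* Since [1 + p^2] and [1 + q^2] are [(1 + s^2) * (1 + t^2)] over the squares of [1 - s * t] and
     [1 + s * t], the factors [1 - s * t] and [1 + s * t] from [Atheta] and [Btheta] cancel and both
     numerators equal [T]. *)
  set T := Num.sqrt ((1 + s ^+ 2) * (1 + t ^+ 2)).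
  have -> : Num.sqrt (1 + p ^+ 2) = T / (1 - s * t).
    rewrite -[X in _ / X]ger0_norm ?(ltW D1)// -sqrtr_sqr -sqrtrV ?sqr_ge0//.
    rewrite /T -sqrtrM ?mulr_ge0 ?(ltW (E0 _))//; congr Num.sqrt.
    by rewrite /p; field; rewrite gt_eqF.
  have -> : Num.sqrt (1 + q ^+ 2) = T / (1 + s * t).
    rewrite -[X in _ / X]ger0_norm ?(ltW D2)// -sqrtr_sqr -sqrtrV ?sqr_ge0//.
    rewrite /T -sqrtrM ?mulr_ge0 ?(ltW (E0 _))//; congr Num.sqrt.
    by rewrite /q; field; rewrite gt_eqF.
  by field; rewrite !gt_eqF.
have derive_f z : z \in `[1, 1 + l] -> derive1 f z = X z.
  by move=> /df[d _ _ _]; exact: is_derive_derive1.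
exists f; split => //.
- by rewrite ltrDl.
- rewrite /ell lt_max; apply/orP; right.
  (* The slope condition defining [ell] holds at every height, so any height above [1 + l] would
     serve. *)
  apply: (@lt_le_trans _ _ (2 + l)%:E); first by rewrite lte_fin; lra.
  apply: ereal_sup_ubound; exists (2 + l) => //; split.
    by apply: in_heights; lra.
  by rewrite drhoE cot_theta r1_ltt.
- by move=> z /fE[/(lt_le_trans ltr01)].
- by move=> z zI; rewrite (derive_f z zI); case: (df z zI) => _ _ -> _; case: (fE z zI).
- move=> _ [w hw] [z [-> | ->] ->].
    by exists w => //; exists 1; [exact: in_heights | rewrite rho1].
  by exists w => //; exists (1 + l); [apply: in_heights; lra | rewrite rhol'].
- move=> _ [w hw] [z zI ->]; have := zI; rewrite /= in_itv/= => /andP[z1 zl].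
  apply: body_interior => //; first exact: lt_trans z1.
  have zI' : z \in `[1, 1 + l] by rewrite in_itv/= !ltW.
  have [fz _ _] := fE z zI'.
  rewrite enormZ (hw : enorm w = 1) mulr1 ger0_norm ?(le_trans ler01)//.
  exact: below.
- by rewrite drhoE r11 derive_f// X1 atan_q.
- by rewrite drhoE r1l derive_f// X2 atan_p.
Qed.
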